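(* Let $S$ be a Borel subset of a Polish space equipped with a partial order $\le_S$. Let $K_1$ and $K_2$ be two bounded non-negative linear operators on $\mathcal{B}(S)$ such that: (i) there exists a non-negative measurable function $h$ on $S$ such that $[K_1(g)](x)\ge h(x)\,[K_2(g)](x)$ for all $x\in S$ and all $g\in\mathcal{B}_{+,>}(S)$; (ii) $K_1$ is non-decreasing with respect to $\le_S$, i.e. $K_1$ maps $\mathcal{B}_{+,>}(S)$ to itself. Then for every $g\in\mathcal{B}_{+,>}(S)$ and every integer $n\ge1$, $$K_1^n(g)\ \ge\ K_{2,h}^n(g)\quad\text{pointwise on } S,$$ where $[K_{2,h}(g)](x):=h(x)\,[K_2(g)](x)$.
   Context: $\mathcal{B}(S)$ is the space of bounded measurable real functions on $S$ with the sup norm. $\mathcal{B}_{+,>}(S)$ is the class of bounded, non-negative measurable functions on $S$ that are non-decreasing with respect to $\le_S$. An operator $K$ on $\mathcal{B}(S)$ is non-negative if $g\ge0$ implies $Kg\ge 0$. Powers denote iterated application of the operator. *)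

(* Defs.v *)
From HB Require Import structures.
From mathcomp Require Import all_boot all_order all_algebra.
From mathcomp Require Import all_classical all_reals all_analysis.
From mathcomp Require Import measurable_realfun.

Set Implicit Arguments.
Unset Strict Implicit.
Unset Printing Implicit Defensive.

Import Order.TTheory GRing.Theory Num.Theory.
Import numFieldNormedType.Exports.

Local Open Scope classical_set_scope.
Local Open Scope ring_scope.

(* Separable and completely metrizable; the metric is not part of the data.
   The empty space is allowed, hence no use of the library's pointed complete
   (pseudo)metric types. *)
Definition polish (R : realType) (E : topologicalType) : Prop :=
  (exists2 D : set E, countable D & dense D) /\
  exists dist : E -> E -> R,
    [/\ (forall x y, dist x y = 0 <-> x = y),
        (forall x y, dist x y = dist y x),
        (forall x y z, dist x z <= dist x y + dist y z),
        (forall (x : E) (A : set E), nbhs x A <->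
           exists2 e : R, 0 < e & [set y | dist x y < e] `<=` A) &
        (forall u : nat -> E,
           (forall e : R, 0 < e -> exists N : nat, forall m n : nat,
              (N <= m)%N -> (N <= n)%N -> dist (u m) (u n) < e) ->
           exists l : E, u @ \oo --> l)].

Definition borel (T : topologicalType) : set (set T) :=
  <<s [set U : set T | open U] >>.

(* The library's measurable types are pointed, which would exclude an empty
   domain; [borel_funE] identifies [borel_fun] with [measurable_fun] on
   pointed spaces. *)
Definition borel_fun (R : realType) (T : topologicalType) (f : T -> R) : Prop :=
  forall B : set R, measurable B -> borel (f @^-1` B).

Lemma borel_funE (R : realType) (T : ptopologicalType) (f : T -> R) :
  borel_fun f <->
  measurable_fun setT
    (f : g_sigma_algebraType [set U : set T | open U] -> R).
Proof.
split=> [mf _ B mB|mf B mB]; first by rewrite setTI; exact: mf.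
by have := mf measurableT B mB; rewrite setTI.
Qed.

Section borel_fun_theory.
Context (R : realType) (T : topologicalType).
Implicit Types f g : T -> R.

Let pt (x0 : T) : pointedType := HB.pack T (isPointed.Build T x0).
Let mT (x0 : T) := @g_sigma_algebraType (pt x0) [set U : set T | open U].

Let borel_pointed (x0 : T) f :
  borel_fun f <-> measurable_fun setT (f : mT x0 -> R).
Proof.
split=> [mf _ B mB|mf B mB]; first by rewrite setTI; exact: mf.
by have := mf measurableT B mB; rewrite setTI.
Qed.

Let borel_empty f : (T -> False) -> borel_fun f.
Proof.
move=> T0 B _; rewrite (_ : f @^-1` B = set0); first exact: sigma_algebra0.
by apply/seteqP; split=> x; have := T0 x.
Qed.

Let inhP (P : Prop) : ((T -> False) -> P) -> (T -> P) -> P.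
Proof.
move=> P0 P1; have [[x _]|T0] := pselect (exists _ : T, True); first exact: P1.
by apply: P0 => x; apply: T0; exists x.
Qed.

Lemma borel_fun_cst (c : R) : borel_fun (fun _ : T => c).
Proof.
apply: inhP => [|x0]; first exact: borel_empty.
by apply/(borel_pointed x0); exact: measurable_cst.
Qed.

Lemma borel_funD f g : borel_fun f -> borel_fun g -> borel_fun (f \+ g).
Proof.
apply: inhP => [T0 _ _|x0]; first exact: borel_empty.
move=> /(borel_pointed x0) mf /(borel_pointed x0) mg; apply/(borel_pointed x0).
exact: measurable_funD.
Qed.

Lemma borel_funM f g : borel_fun f -> borel_fun g -> borel_fun (f \* g).
Proof.
apply: inhP => [T0 _ _|x0]; first exact: borel_empty.
move=> /(borel_pointed x0) mf /(borel_pointed x0) mg; apply/(borel_pointed x0).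
exact: measurable_funM.
Qed.

End borel_fun_theory.

Section bounded_measurable.
Context (R : realType) (T : topologicalType).

Lemma bounded_funE (f : T -> R) :
  bounded_fun f <-> exists M : R, forall x, `|f x| <= M.
Proof.
split=> [|[M fM]].
  move=> /pinfty_ex_gt0[M _ fM]; exists M => x; exact: fM.
exists M; split; first exact: num_real.
by move=> N MN x _ /=; exact: le_trans (ltW MN).
Qed.

Definition bmfun_pred : {pred T -> R} :=
  mem [set f : T -> R | borel_fun f /\ bounded_fun f].

Lemma bmfun_predP (f : T -> R) :
  f \in bmfun_pred <-> borel_fun f /\ bounded_fun f.
Proof. by split=> [/set_mem|] // Hf; exact: mem_set. Qed.

Lemma bmfun_submod_closed : submod_closed bmfun_pred.
Proof.
split=> [|a f g /bmfun_predP[mf /bounded_funE[M fM]]].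
  apply/bmfun_predP; split; first exact: borel_fun_cst.
  by apply/bounded_funE; exists 0 => x; rewrite normr0.
move=> /bmfun_predP[mg /bounded_funE[N gN]]; apply/bmfun_predP; split.
  by apply: borel_funD => //; apply: borel_funM => //; exact: borel_fun_cst.
apply/bounded_funE; exists (`|a| * M + N) => x.
by rewrite (le_trans (ler_normD _ _))// lerD// normrM ler_wpM2l.
Qed.

HB.instance Definition _ :=
  GRing.isSubmodClosed.Build R (T -> R) bmfun_pred bmfun_submod_closed.

Record bmfun := BMFun { bmfun_val :> T -> R ; _ : bmfun_val \in bmfun_pred }.

HB.instance Definition _ := [isSub for bmfun_val].
HB.instance Definition _ := [Choice of bmfun by <:].
HB.instance Definition _ := [SubChoice_isSubLmodule of bmfun by <:].


Lemma bmfun_borel (f : bmfun) : borel_fun f.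
Proof. by have /bmfun_predP[] := valP f. Qed.

Lemma bmfun_bounded (f : bmfun) : exists M : R, forall x, `|f x| <= M.
Proof. by have /bmfun_predP[_ /bounded_funE] := valP f. Qed.

Lemma bmfun_cst_subproof (c : R) : (fun _ : T => c) \in bmfun_pred.
Proof.
apply/bmfun_predP; split; first exact: borel_fun_cst.
by apply/bounded_funE; exists `|c|.
Qed.

Definition bmfun_cst (c : R) : bmfun := BMFun (bmfun_cst_subproof c).

Definition sup_norm (f : bmfun) : R := sup [set `|f x| | x in [set: T]].

Lemma le_sup_norm (f : bmfun) x : `|f x| <= sup_norm f.
Proof.
have [M fM] := bmfun_bounded f; apply: ub_le_sup; last by exists x.
by exists M => _ [y _ <-].
Qed.

Lemma sup_norm_le (f : bmfun) (M : R) :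
  0 <= M -> (forall x, `|f x| <= M) -> sup_norm f <= M.
Proof.
move=> M0 fM; have [[x _]|T0] := pselect (exists _ : T, True).
  by apply: ge_sup => [|_ [y _ <-]//]; exists `|f x|; exists x.
rewrite /sup_norm (_ : [set _ | _ in _] = set0) ?sup0//.
by apply/seteqP; split=> // y [x _ _]; case: T0; exists x.
Qed.

Lemma sup_norm_ge0 (f : bmfun) : 0 <= sup_norm f.
Proof.
have [[x _]|T0] := pselect (exists _ : T, True).
  exact: le_trans (le_sup_norm f x).
rewrite /sup_norm (_ : [set _ | _ in _] = set0) ?sup0//.
by apply/seteqP; split=> // y [x _ _]; case: T0; exists x.
Qed.

Lemma sup_normD (f g : bmfun) : sup_norm (f + g) <= sup_norm f + sup_norm g.
Proof.
apply: sup_norm_le => [|x]; first by rewrite addr_ge0 ?sup_norm_ge0.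
by rewrite (le_trans (ler_normD _ _))// lerD ?le_sup_norm.
Qed.

Lemma sup_normZ (a : R) (f : bmfun) : sup_norm (a *: f) = `|a| * sup_norm f.
Proof.
have leZ b g : sup_norm (b *: g) <= `|b| * sup_norm g.
  apply: sup_norm_le => [|x]; first by rewrite mulr_ge0 ?sup_norm_ge0.
  by rewrite [X in X <= _]normrM ler_wpM2l ?le_sup_norm.
apply/eqP; rewrite eq_le leZ /=; have [->|a0] := eqVneq a 0.
  by rewrite normr0 mul0r sup_norm_ge0.
rewrite -ler_pdivlMl ?normr_gt0//; have := leZ a^-1 (a *: f).
by rewrite scalerA mulVf// scale1r normfV.
Qed.

Lemma sup_norm0_eq0 (f : bmfun) : sup_norm f = 0 -> f = 0.
Proof.
move=> f0; apply/val_inj/funext => x /=; apply/eqP.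
by rewrite -normr_le0 -f0 le_sup_norm.
Qed.

HB.instance Definition _ :=
  Lmodule_isNormed.Build R bmfun sup_normD sup_normZ sup_norm0_eq0.

End bounded_measurable.

Arguments bmfun R T : clear implicits.

Lemma bmfun_normE (R : realType) (T : topologicalType) (f : bmfun R T) :
  `|f| = sup [set `|f x| | x in [set: T]].
Proof. by []. Qed.

Section operators.
Context (R : realType) (T : topologicalType).
Implicit Types (g : bmfun R T) (K : bmfun R T -> bmfun R T) (le : rel T) (h : T -> R).

Definition bounded_operator K : Prop :=
  exists M : R, forall g, `|K g| <= M * `|g|.

Definition nonneg_operator K : Prop :=
  forall g, (forall x, 0 <= g x) -> forall x, 0 <= K g x.

Definition nonneg_nondecreasing le : set (bmfun R T) :=
  [set g | (forall x, 0 <= g x) /\ (forall x y, le x y -> g x <= g y)].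

Definition nondecreasing_operator le K : Prop :=
  forall g, nonneg_nondecreasing le g -> nonneg_nondecreasing le (K g).

Definition dominates le K1 K2 h : Prop :=
  forall x g, nonneg_nondecreasing le g -> h x * K2 g x <= K1 g x.

(* [h] may be unbounded: [h * K2 g] is bounded because
   [h * K2 c <= K1 c] for the nonnegative constants [c]. *)
Lemma weighted_subproof le (K1 : bmfun R T -> bmfun R T)
    (K2 : {linear bmfun R T -> bmfun R T}) h :
  nonneg_operator K2 -> borel_fun h -> (forall x, 0 <= h x) ->
  dominates le K1 K2 h ->
  forall g, (fun x => h x * K2 g x) \in @bmfun_pred R T.
Proof.
move=> K2_ge0 mh h0 K12 g; apply/bmfun_predP; split.
  by apply: borel_funM => //; exact: bmfun_borel.
set c := bmfun_cst T `|g|; have [M K1M] := bmfun_bounded (K1 c).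
have gc x : `|g x| <= `|g| by exact: le_sup_norm.
apply/bounded_funE; exists M => x.
have c_mem : nonneg_nondecreasing le c by split=> [y|y z _] /=.
apply: le_trans (K1M x); apply: le_trans (ler_norm _).
apply: le_trans (K12 x c c_mem); rewrite normrM ger0_norm// ler_wpM2l//.
rewrite ler_norml; apply/andP; split.
- have H y : 0 <= (c + g) y.
    have : - `|g| <= g y by have := gc y; rewrite ler_norml => /andP[].
    by rewrite -subr_ge0 opprK addrC.
  have := K2_ge0 _ H x; rewrite linearD /= => H2.
  by rewrite -subr_ge0 opprK addrC.
- have H y : 0 <= (c - g) y.
    by have : g y <= `|g| by [exact: le_trans (ler_norm _) (gc y)]; rewrite -subr_ge0.
  have := K2_ge0 _ H x; rewrite linearB /= => H2.
  by rewrite -subr_ge0.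
Qed.

Definition weighted le (K1 : bmfun R T -> bmfun R T)
    (K2 : {linear bmfun R T -> bmfun R T}) h
    (K2_ge0 : nonneg_operator K2) (mh : borel_fun h)
    (h_ge0 : forall x, 0 <= h x) (K12 : dominates le K1 K2 h) :
    bmfun R T -> bmfun R T :=
  fun g => BMFun (weighted_subproof K2_ge0 mh h_ge0 K12 g).

End operators.

(* Main.v *)
(* Both iterations are compared one step at a time: a nonnegative linear
   operator is monotone, so K_{2,h}(K_{2,h}^n g) <= K_{2,h}(K_1^n g), and
   K_1^n g is still nonnegative and nondecreasing, so the domination hypothesis
   bounds the latter by K_1(K_1^n g). *)

Require Import Defs.
From mathcomp Require Import all_boot all_order all_algebra.
From mathcomp Require Import all_classical all_reals all_analysis.

Import Order.TTheory GRing.Theory Num.Theory.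
Import numFieldNormedType.Exports.

Local Open Scope classical_set_scope.
Local Open Scope ring_scope.

(** By linearity [K g - K f = K (g - f)], and [g - f] is nonnegative. *)
Lemma nonneg_operator_le (R : realType) (T : topologicalType)
    (K : {linear bmfun R T -> bmfun R T}) (f g : bmfun R T) :
  nonneg_operator K -> (forall x, f x <= g x) -> forall x, K f x <= K g x.
Proof.
move=> K_ge0 fg x.
have gf y : 0 <= (g - f) y by have := fg y; rewrite -subr_ge0.
by have := K_ge0 _ gf x; rewrite linearB /= => ?; rewrite -subr_ge0.
Qed.

Lemma iter_nondecreasing_operator (R : realType) (T : topologicalType)
    (le : rel T) (K : bmfun R T -> bmfun R T) (g : bmfun R T) (n : nat) :
  nondecreasing_operator le K -> nonneg_nondecreasing le g ->
  nonneg_nondecreasing le (iter n K g).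
Proof. by move=> K_nd gP; elim: n => // n; exact: K_nd. Qed.

Theorem lemma1p5 (R : realType) (E : topologicalType) (S : set E)
    (leS : rel S) (K1 K2 : {linear bmfun R S -> bmfun R S}) (h : S -> R)
    (polishE : polish R E) (borelS : borel S)
    (leS_refl : reflexive leS) (leS_anti : antisymmetric leS)
    (leS_trans : transitive leS)
    (K1_bounded : bounded_operator K1) (K2_bounded : bounded_operator K2)
    (K1_ge0 : nonneg_operator K1) (K2_ge0 : nonneg_operator K2)
    (h_borel : borel_fun h) (h_ge0 : forall x, 0 <= h x)
    (K1_dom : dominates leS K1 K2 h)
    (K1_nondecreasing : nondecreasing_operator leS K1) :
  forall (g : bmfun R S), nonneg_nondecreasing leS g ->
  forall n : nat, (1 <= n)%N ->
  forall x : S,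
    iter n (weighted K2_ge0 h_borel h_ge0 K1_dom) g x <= iter n K1 g x.
Proof.
(* The induction starts at exponent 0, where both iterates are [g]. *)
move=> g gP n _; elim: n => [//|n IHn] x /=.
have gnP : nonneg_nondecreasing leS (iter n K1 g).
  exact: iter_nondecreasing_operator.
(* The middle term is [h x * K2 (iter n K1 g) x]. *)
apply: le_trans (K1_dom x _ gnP).
(* [weighted] unfolds by conversion to [h x * K2 _ x]; the factor [h x >= 0] cancels, and
   monotonicity of [K2] applies to [IHn]. *)
by apply: ler_wpM2l => //; exact: nonneg_operator_le.
Qed.
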